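(* Consider the mixed-integer second-stage problem $$Q(x,\xi)=\min_{y,z}\{q^Ty+r^Tz : W_yy+W_zz\le h(\xi)-T(\xi)x,\ y\ge 0,\ z\in\mathbb Z_+^{n_I}\},\qquad x\in X,\ \xi\in\Xi,$$ where only $h(\xi)$ and $T(\xi)$ depend on the scenario $\xi$, and let $Q_{LP}(x,\xi)$ denote the value of its LP relaxation. Assume: - there exists $M_\pi>0$ such that for all $x\in X$, all $\xi\in\Xi$ and all optimal solutions $\pi^*$ of the dual of the LP relaxation at $(x,\xi)$, one has $\|\pi^*\|_\infty\le M_\pi$; - there exists $\gamma>0$ such that $\sup_{x\in X,\,\xi\in\Xi}[Q(x,\xi)-Q_{LP}(x,\xi)]\le\gamma$; - there is a constant $\bar R$ such that $\|x\|_\infty\le\bar R$ for all $x\in X$. Then for all $\xi,\xi'\in\Xi$ the regret $R(\xi,\xi')=\sup_{x\in X}[Q(x,\xi)-Q(x,\xi')]$ satisfies $$R(\xi,\xi')\le M_\pi\left[\|h(\xi)-h(\xi')\|_1+\bar R\,\|T(\xi)-T(\xi')\|_1\right]+\gamma.$$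
   Context: $X\subseteq\mathbb R^{n_1}$ is closed and nonempty, $\Xi\subseteq\mathbb R^d$, $q\in\mathbb R^{n_C}$, $r\in\mathbb R^{n_I}$, $W_y\in\mathbb R^{m\times n_C}$, $W_z\in\mathbb R^{m\times n_I}$, $h:\Xi\to\mathbb R^m$ and $T:\Xi\to\mathbb R^{m\times n_1}$. Inequalities between vectors are componentwise. The mixed-integer problem is feasible for every $(x,\xi)\in X\times\Xi$ (relatively complete recourse) and its minimum is attained, so $Q$ is real-valued. The LP relaxation replaces $z\in\mathbb Z_+^{n_I}$ by $z\in\mathbb R^{n_I}$, $z\ge0$. Its dual at $(x,\xi)$ is $$\max_{\pi\in\mathbb R^m}\{\pi^T[h(\xi)-T(\xi)x] : W_y^T\pi\le q,\ W_z^T\pi\le r,\ \pi\le 0\}.$$ For vectors, $\|\cdot\|_1$ and $\|\cdot\|_\infty$ are the usual $\ell^1$ and $\ell^\infty$ norms; for matrices, $\|A\|_1=\sum_{i,j}|A_{ij}|$ is the entrywise $\ell^1$ norm. *)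

(* Defs.v *)
From HB Require Import structures.
From mathcomp Require Import all_boot all_order all_algebra archimedean.
From mathcomp Require Import all_classical all_reals all_analysis.

Set Implicit Arguments.
Unset Strict Implicit.
Unset Printing Implicit Defensive.

Import Order.TTheory GRing.Theory Num.Theory numFieldNormedType.Exports.
Local Open Scope classical_set_scope.
Local Open Scope ring_scope.

(* The sup norm is the library norm `|x| on matrices (mx_norm), the maximum of
   the absolute values of the entries. *)

Definition cvle {R : numDomainType} {n : nat} (u v : 'cV[R]_n) : Prop :=
  forall i, u i ord0 <= v i ord0.

Definition dotcv {R : pzRingType} {n : nat} (u v : 'cV[R]_n) : R :=
  (u^T *m v) ord0 ord0.

(* Entrywise, hence the usual l1 norm on column vectors; not the operator
   norm induced by the l1 vector norm. *)
Definition norm1 {R : numDomainType} {m n : nat} (A : 'M[R]_(m, n)) : R :=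
  \sum_(i < m) \sum_(j < n) `|A i j|.

Definition is_minimizer {R : realType} {V : Type} (f : V -> R) (S : set V)
    (v : V) : Prop := S v /\ forall w, S w -> f v <= f w.

Definition is_maximizer {R : realType} {V : Type} (f : V -> R) (S : set V)
    (v : V) : Prop := S v /\ forall w, S w -> f w <= f v.

(* Optimal value of a minimization problem: +oo when infeasible, -oo when
   unbounded below, and (f v)%:E when v is a minimizer. *)
Definition min_value {R : realType} {V : Type} (f : V -> R) (S : set V) :
    \bar R := ereal_inf [set (f v)%:E | v in S].

Section SecondStage.
Context {R : realType} {nC nI m : nat}.
Variables (q : 'cV[R]_nC) (r : 'cV[R]_nI).
Variables (Wy : 'M[R]_(m, nC)) (Wz : 'M[R]_(m, nI)).

Definition cost (yz : 'cV[R]_nC * 'cV[R]_nI) : R :=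
  dotcv q yz.1 + dotcv r yz.2.

(* b stands for the right-hand side h(xi) - T(xi) x. *)
Definition mip_feasible (b : 'cV[R]_m) : set ('cV[R]_nC * 'cV[R]_nI) :=
  [set yz | [/\ cvle (Wy *m yz.1 + Wz *m yz.2) b, cvle 0 yz.1
              & forall i, yz.2 i ord0 \is a Num.nat]].

Definition lp_feasible (b : 'cV[R]_m) : set ('cV[R]_nC * 'cV[R]_nI) :=
  [set yz | [/\ cvle (Wy *m yz.1 + Wz *m yz.2) b, cvle 0 yz.1
              & cvle 0 yz.2]].

Definition dual_feasible : set 'cV[R]_m :=
  [set p | [/\ cvle (Wy^T *m p) q, cvle (Wz^T *m p) r & cvle p 0]].

Definition dual_optimal (b : 'cV[R]_m) (p : 'cV[R]_m) : Prop :=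
  is_maximizer (fun p' => dotcv p' b) dual_feasible p.

End SecondStage.

Section Recourse.
Context {R : realType} {n1 d nC nI m : nat}.
Variables (q : 'cV[R]_nC) (r : 'cV[R]_nI).
Variables (Wy : 'M[R]_(m, nC)) (Wz : 'M[R]_(m, nI)).
Variables (h : 'cV[R]_d -> 'cV[R]_m) (T : 'cV[R]_d -> 'M[R]_(m, n1)).

Definition rhs (x : 'cV[R]_n1) (xi : 'cV[R]_d) : 'cV[R]_m :=
  h xi - T xi *m x.

Definition Q (x : 'cV[R]_n1) (xi : 'cV[R]_d) : \bar R :=
  min_value (cost q r) (mip_feasible Wy Wz (rhs x xi)).

Definition QLP (x : 'cV[R]_n1) (xi : 'cV[R]_d) : \bar R :=
  min_value (cost q r) (lp_feasible Wy Wz (rhs x xi)).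

Definition regret (X : set 'cV[R]_n1) (xi xi' : 'cV[R]_d) : \bar R :=
  ereal_sup [set (Q x xi - Q x xi')%E | x in X].

End Recourse.

(* Main.v *)
Require Import Defs.
From HB Require Import structures.
From mathcomp Require Import all_boot all_order all_algebra archimedean.
From mathcomp Require Import all_classical all_reals all_analysis.
From mathcomp Require Import lra.

Set Implicit Arguments.
Unset Strict Implicit.
Unset Printing Implicit Defensive.

Import Order.TTheory GRing.Theory Num.Theory numFieldNormedType.Exports.
Local Open Scope classical_set_scope.
Local Open Scope ring_scope.

(** The integrality gap lets the regret be compared through the relaxation:
    the gap bound at [xi] gives [Q(x, xi) <= QLP(x, xi) + gamma], while
    [QLP(x, xi') <= Q(x, xi')] because relaxing enlarges the feasible set.  It
    remains to bound [QLP(x, xi) - QLP(x, xi')].  The dual feasible region does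
    not depend on the scenario, so an optimal dual solution [p] at [(x, xi)] is
    still feasible at [(x, xi')]; strong duality at [xi] and weak duality at
    [xi'] bound the difference by [p^T (b - b')], where [b] and [b'] are the two
    right-hand sides.  Hoelder's inequality, with the assumed bounds on [p] and
    [x], finishes the argument.

    The existence of [p] ([lp_dual_attained]) is the deep ingredient.  The
    relaxation has a finite value, being at most [Q] and at least [Q - gamma].
    That this value is a lower bound of the cost over the polyhedron
    [A x <= b, x >= 0] becomes, after homogenization with one extra variable, a
    statement about a polyhedral cone; the homogeneous Farkas lemma ([farkas])
    then supplies multipliers, which form a dual solution whose objective
    reaches the value exactly.  Working with the cone makes attainment come for
    free: applying an inhomogeneous Farkas lemma to [cost <= value - eps] would
    only give a dual solution optimal up to [eps]. *)

(** * Scalar products and componentwise inequalities *)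

Section VectorInequalities.
Context {R : numDomainType}.

Lemma dotcvE n (u v : 'cV[R]_n) : dotcv u v = \sum_i u i ord0 * v i ord0.
Proof. by rewrite /dotcv mxE; apply: eq_bigr => i _; rewrite mxE. Qed.

Lemma ler_dotcv n (w u v : 'cV[R]_n) :
  cvle 0 w -> cvle u v -> dotcv w u <= dotcv w v.
Proof.
move=> w0 uv; rewrite !dotcvE; apply: ler_sum => i _; apply: ler_wpM2l => //.
by have := w0 i; rewrite mxE.
Qed.

Lemma dotcvC n (u v : 'cV[R]_n) : dotcv u v = dotcv v u.
Proof. by rewrite !dotcvE; apply: eq_bigr => i _; rewrite mulrC. Qed.

Lemma dotcvNl n (u v : 'cV[R]_n) : dotcv (- u) v = - dotcv u v.
Proof. by rewrite /dotcv linearN mulNmx mxE. Qed.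

Lemma dotcvBr n (w u v : 'cV[R]_n) : dotcv w (u - v) = dotcv w u - dotcv w v.
Proof. by rewrite /dotcv mulmxBr !mxE. Qed.

Lemma dotcvDr n (w u v : 'cV[R]_n) : dotcv w (u + v) = dotcv w u + dotcv w v.
Proof. by rewrite /dotcv mulmxDr !mxE. Qed.

Lemma dotcvZr n (w u : 'cV[R]_n) a : dotcv w (a *: u) = a * dotcv w u.
Proof. by rewrite /dotcv -scalemxAr mxE. Qed.

Lemma dotcv_mulmxr m n (A : 'M[R]_(m, n)) (p : 'cV[R]_m) (x : 'cV[R]_n) :
  dotcv p (A *m x) = dotcv (A^T *m p) x.
Proof. by rewrite /dotcv trmx_mul trmxK mulmxA. Qed.

Lemma dotcv_col_mx n1 n2 (u1 v1 : 'cV[R]_n1) (u2 v2 : 'cV[R]_n2) :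
  dotcv (col_mx u1 u2) (col_mx v1 v2) = dotcv u1 v1 + dotcv u2 v2.
Proof. by rewrite /dotcv tr_col_mx mul_row_col mxE. Qed.

Lemma cvle_col_mx n1 n2 (u1 v1 : 'cV[R]_n1) (u2 v2 : 'cV[R]_n2) :
  cvle (col_mx u1 u2) (col_mx v1 v2) <-> cvle u1 v1 /\ cvle u2 v2.
Proof.
split=> [le|[le1 le2] i].
  split=> i.
    by have := le (lshift n2 i); rewrite !col_mxEu.
  by have := le (rshift n1 i); rewrite !col_mxEd.
by case: (split_ordP i) => j ->; rewrite ?col_mxEu ?col_mxEd.
Qed.

End VectorInequalities.

(** * The Farkas lemma and linear programming duality *)

(** Bartl's induction on the number of inequalities.  If the inequality [a]
    cannot be dropped, some [w] satisfies all the others but violates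
    [g w <= 0]; then [a w > 0], and [w] can be scaled so that [a w = 1].  The
    projection [P = 1 - w a] onto the hyperplane [a = 0] removes [a] from the
    system, and the multipliers [y] found for [g P] serve for [g], with the
    remaining one, [(g - y B) w], for [a].  This last is nonnegative because
    [g w > 0] and [B w <= 0]. *)
Lemma farkas (R : realFieldType) m n (A : 'M[R]_(m, n)) (g : 'rV[R]_n) :
  (forall x, cvle (A *m x) 0 -> (g *m x) ord0 ord0 <= 0) ->
  exists2 y : 'rV[R]_m, (forall i, 0 <= y ord0 i) & g = y *m A.
Proof.
elim: m A g => [|m IH] A g.
  move=> gle0; exists 0 => [i|]; first by rewrite mxE.
  rewrite mul0mx; apply/rowP => j; rewrite mxE.
  pose v e : 'cV[R]_n := e *: delta_mx j ord0.
  have gleP e : (g *m v e) ord0 ord0 <= 0 by apply: gle0 => -[].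
  have gE e : (g *m v e) ord0 ord0 = e * g ord0 j.
    by rewrite -scalemxAr -colE !mxE.
  have := gleP 1; have := gleP (-1); rewrite !gE => ? ?; lra.
rewrite -[m.+1]/(1 + m)%N in A *; rewrite -(vsubmxK A).
set a := usubmx A; set B := dsubmx A => gle0.
have [sub|nsub] :=
  pselect (forall x, cvle (B *m x) 0 -> (g *m x) ord0 ord0 <= 0).
  have [y y0 ->] := IH B g sub; exists (row_mx 0 y); last first.
    by rewrite mul_row_col mul0mx add0r.
  move=> i; case: (split_ordP i) => j ->.
    by rewrite row_mxEl mxE.
  by rewrite row_mxEr.
have [v [Bv0 gv_gt0]] :
    exists v, cvle (B *m v) 0 /\ 0 < (g *m v) ord0 ord0.
  apply: contrapT => nex; apply: nsub => x Bx0; rewrite leNgt.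
  by apply/negP => gx; apply: nex; exists x.
have av_gt0 : 0 < (a *m v) ord0 ord0.
  rewrite ltNge; apply/negP => av; suff: (g *m v) ord0 ord0 <= 0 by lra.
  apply: gle0; rewrite mul_col_mx -col_mx0; apply/cvle_col_mx; split => //.
  by move=> i; rewrite [i]ord1 [leRHS]mxE.
set t := (a *m v) ord0 ord0 in av_gt0.
pose w := t^-1 *: v.
have aw1 : a *m w = 1%:M.
  rewrite -scalemxAr [a *m v]mx11_scalar -/t scale_scalar_mx mulVf //.
  exact: lt0r_neq0.
have Bw0 : cvle (B *m w) 0.
  move=> i; rewrite -scalemxAr !mxE -oppr_ge0 -mulrN; apply: mulr_ge0.
    by rewrite invr_ge0 ltW.
  by rewrite oppr_ge0; have := Bv0 i; rewrite !mxE.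
have gw_gt0 : 0 < (g *m w) ord0 ord0.
  by rewrite -scalemxAr mxE mulr_gt0 // invr_gt0.
pose P := 1%:M - w *m a.
have aP0 : a *m P = 0 by rewrite mulmxBr mulmx1 mulmxA aw1 mul1mx subrr.
have [y y0 gP] : exists2 y : 'rV[R]_m,
    (forall i, 0 <= y ord0 i) & g *m P = y *m (B *m P).
  apply: IH => x; rewrite -!mulmxA => BPx; apply: gle0.
  rewrite mul_col_mx mulmxA aP0 mul0mx -col_mx0; apply/cvle_col_mx; split => //.
exists (row_mx ((g - y *m B) *m w) y).
  move=> i; case: (split_ordP i) => j ->; last by rewrite row_mxEr.
  rewrite row_mxEl [j]ord1 mulmxBl mxE addr_ge0 ?(ltW gw_gt0) // -mulmxA.
  rewrite mxE oppr_ge0 mxE; apply: sumr_le0 => k _.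
  by apply: mulr_ge0_le0 => //; have := Bw0 k; rewrite [leRHS]mxE.
rewrite mul_row_col !mulmxBl.
move: gP; rewrite mulmxA !mulmxBr !mulmx1 !mulmxA.
move/eqP; rewrite subr_eq => /eqP gE; rewrite [LHS]gE.
by rewrite addrC addrA [RHS]addrAC.
Qed.

Section LinearProgramming.
Context {R : realFieldType} {m n : nat}.
Variables (A : 'M[R]_(m, n)) (b : 'cV[R]_m) (c : 'cV[R]_n).

Lemma lp_weak_duality p x :
  cvle (A^T *m p) c -> cvle p 0 -> cvle (A *m x) b -> cvle 0 x ->
  dotcv p b <= dotcv c x.
Proof.
move=> Apc p0 Axb x0; have Np0 : cvle 0 (- p).
  by move=> i; rewrite !mxE oppr_ge0; have := p0 i; rewrite mxE.
have := ler_dotcv Np0 Axb; rewrite !dotcvNl lerN2 => /le_trans; apply.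
by rewrite dotcv_mulmxr dotcvC [leRHS]dotcvC; apply: ler_dotcv.
Qed.

(** A lower bound [beta] of the cost extends to the cone over the polyhedron:
    for [t > 0] by scaling, and for a recession direction ([t = 0]) because
    moving far along it from a feasible point would otherwise push the cost
    below [beta]. *)
Lemma lp_homogeneous_bound beta x0 x t :
  (forall x, cvle (A *m x) b -> cvle 0 x -> beta <= dotcv c x) ->
  cvle (A *m x0) b -> cvle 0 x0 ->
  cvle (A *m x) (t *: b) -> cvle 0 x -> 0 <= t -> t * beta <= dotcv c x.
Proof.
move=> lb Ax0 x00 Ax xge0; rewrite le_eqVlt => /predU1P[t0|t0]; last first.
  have -> : dotcv c x = t * dotcv c (t^-1 *: x).
    by rewrite dotcvZr mulrA mulfV ?mul1r // gt_eqF.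
  rewrite ler_pM2l //; apply: lb => i; last first.
    rewrite !mxE mulr_ge0 ?invr_ge0 ?(ltW t0) //.
    by have := xge0 i; rewrite mxE.
  by rewrite -scalemxAr mxE ler_pdivrMl //; have := Ax i; rewrite !mxE.
rewrite -t0 mul0r leNgt; apply/negP => cx_lt0.
have step s : 0 <= s -> beta <= dotcv c x0 + s * dotcv c x.
  move=> s0; rewrite -dotcvZr -dotcvDr; apply: lb => i.
    rewrite mulmxDr -scalemxAr mxE -[leRHS]addr0 lerD //.
    rewrite mxE mulr_ge0_le0 //.
    by have := Ax i; rewrite -t0 scale0r [leRHS]mxE.
  rewrite !mxE addr_ge0 ?mulr_ge0 //.
    by have := x00 i; rewrite mxE.
  by have := xge0 i; rewrite mxE.
(* This step length brings the cost down to exactly [beta - 1]. *)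
pose s := (dotcv c x0 - beta + 1) / - dotcv c x.
have s_ge0 : 0 <= s.
  rewrite divr_ge0 //; last by rewrite oppr_ge0 ltW.
  by have := lb _ Ax0 x00; lra.
have sE : s * dotcv c x = - (dotcv c x0 - beta + 1).
  by rewrite -[dotcv c x in LHS]opprK mulrN divfK // oppr_eq0 lt_eqF.
by have := step s s_ge0; rewrite sE; lra.
Qed.

(** The rows of the matrix given to [farkas] are [A x - t b <= 0], [- x <= 0]
    and [- t <= 0].  The multipliers of the first block are, up to sign, the
    dual solution; those of the other two are the slacks in [A^T p <= c] and
    in [beta <= p^T b]. *)
Lemma lp_dual_witness beta :
  (exists x, cvle (A *m x) b /\ cvle 0 x) ->
  (forall x, cvle (A *m x) b -> cvle 0 x -> beta <= dotcv c x) ->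
  exists p, [/\ cvle (A^T *m p) c, cvle p 0 & beta <= dotcv p b].
Proof.
move=> [x0 [Ax0 x00]] lb.
pose G := col_mx (row_mx A (- b)) (- (1%:M : 'M[R]_(n + 1))).
pose g : 'rV[R]_(n + 1) := row_mx (- c^T) beta%:M.
have [y y_ge0 gE] : exists2 y : 'rV[R]_(m + (n + 1)),
    (forall i, 0 <= y ord0 i) & g = y *m G.
  apply: farkas => z; rewrite -(vsubmxK z).
  set x := usubmx z; set s := dsubmx z.
  rewrite mul_col_mx mul_row_col !mulNmx mul1mx opp_col_mx.
  rewrite -col_mx0 => /cvle_col_mx[Axs].
  rewrite -col_mx0 => /cvle_col_mx[xN sN].
  have -> : (g *m col_mx x s) ord0 ord0 = s ord0 ord0 * beta - dotcv c x.
    rewrite mul_row_col mulNmx mul_scalar_mx mxE addrC; congr (_ + _).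
      by rewrite mxE mulrC.
    by rewrite mxE.
  rewrite subr_le0; apply: (lp_homogeneous_bound lb Ax0 x00) => [i|i|].
  - have := Axs i; rewrite {1}[s]mx11_scalar mul_mx_scalar.
    by rewrite mxE [leRHS]mxE [X in _ + X <= _]mxE subr_le0.
  - by have := xN i; rewrite !mxE oppr_le0.
  - by have := sN ord0; rewrite !mxE oppr_le0.
pose y1 := lsubmx y; pose y2 := lsubmx (rsubmx y); pose y3 := rsubmx (rsubmx y).
have yE : y = row_mx y1 (row_mx y2 y3) by rewrite !hsubmxK.
have [cE betaE] : - c^T = y1 *m A - y2 /\ beta%:M = - (y1 *m b) - y3.
  apply: eq_row_mx; rewrite -/g gE yE mul_row_col mul_mx_row !mulmxN mulmx1.
  by rewrite opp_row_mx add_row_mx.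
exists (- y1^T); split=> [i|i|].
- rewrite mulmxN -trmx_mul -[c]trmxK -[c^T]opprK cE !mxE.
  by rewrite opprB lerBrDr addNr.
- by rewrite !mxE oppr_le0.
rewrite dotcvNl /dotcv trmxK.
have := congr1 (fun M : 'M[R]_1 => M ord0 ord0) betaE.
rewrite !mxE eqxx mulr1n => ->; rewrite gerDl oppr_le0.
exact: y_ge0.
Qed.

End LinearProgramming.

(** * Hoelder bounds for the sup norm and the entrywise l1 norm *)

Section NormBounds.
Context {R : realType}.

Lemma ler_entry_norm m n (A : 'M[R]_(m, n)) i j : `|A i j| <= `|A|.
Proof.
rewrite [leRHS]mx_normrE.
exact: (le_bigmax _ (fun ij => `|A ij.1 ij.2|) (i, j)).
Qed.

Lemma dotcv_le_norm m (p v : 'cV[R]_m) : dotcv p v <= `|p| * norm1 v.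
Proof.
rewrite dotcvE /norm1 mulr_sumr; apply: ler_sum => i _.
rewrite big_ord1 (le_trans (ler_norm _)) // normrM ler_wpM2r //.
exact: ler_entry_norm.
Qed.

Lemma norm1_ge0 m n (A : 'M[R]_(m, n)) : 0 <= norm1 A.
Proof. by apply: sumr_ge0 => i _; apply: sumr_ge0. Qed.

Lemma norm1B_le m n (A B : 'M[R]_(m, n)) : norm1 (A - B) <= norm1 A + norm1 B.
Proof.
rewrite /norm1 -big_split; apply: ler_sum => i _.
by rewrite -big_split; apply: ler_sum => j _; rewrite !mxE ler_normB.
Qed.

Lemma norm1_mulmx_le m n (A : 'M[R]_(m, n)) (x : 'cV[R]_n) :
  norm1 (A *m x) <= `|x| * norm1 A.
Proof.
rewrite /norm1 mulr_sumr; apply: ler_sum => i _; rewrite big_ord1 mxE mulr_sumr.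
apply: le_trans (ler_norm_sum _ _ _) _; apply: ler_sum => j _.
by rewrite normrM mulrC ler_wpM2r // ler_entry_norm.
Qed.

End NormBounds.

(** * The second-stage problem *)

Section SecondStageDuality.
Context {R : realType} {nC nI m : nat}.
Variables (q : 'cV[R]_nC) (r : 'cV[R]_nI).
Variables (Wy : 'M[R]_(m, nC)) (Wz : 'M[R]_(m, nI)).

Lemma costE y z : cost q r (y, z) = dotcv (col_mx q r) (col_mx y z).
Proof. by rewrite dotcv_col_mx. Qed.

Lemma lp_feasibleE b y z : lp_feasible Wy Wz b (y, z) <->
  cvle (row_mx Wy Wz *m col_mx y z) b /\ cvle 0 (col_mx y z).
Proof.
rewrite mul_row_col -[0]col_mx0 cvle_col_mx.
by split=> [[? ? ?]|[? [? ?]]].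
Qed.

Lemma dual_feasibleE p : dual_feasible q r Wy Wz p <->
  cvle ((row_mx Wy Wz)^T *m p) (col_mx q r) /\ cvle p 0.
Proof.
rewrite tr_row_mx mul_col_mx cvle_col_mx.
by split=> [[? ? ?]|[[? ?] ?]].
Qed.

Lemma mip_sub_lp b : mip_feasible Wy Wz b `<=` lp_feasible Wy Wz b.
Proof.
by move=> yz [Wb y0 zN]; split => // i; rewrite mxE; exact: natr_ge0.
Qed.

Lemma min_value_minimizer V (f : V -> R) S v :
  is_minimizer f S v -> min_value f S = (f v)%:E.
Proof.
move=> [Sv vmin]; apply/le_anti/andP; split.
  by apply: ereal_inf_lbound; exists v.
by apply: le_ereal_inf_tmp => _ [w Sw <-]; rewrite lee_fin vmin.
Qed.

Lemma dual_le_lp_value b p : dual_feasible q r Wy Wz p ->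
  ((dotcv p b)%:E <= min_value (cost q r) (lp_feasible Wy Wz b))%E.
Proof.
move=> /dual_feasibleE[Wp p0]; apply: le_ereal_inf_tmp => _ [[y z] yz <-].
have [Wb yz0] := (lp_feasibleE b y z).1 yz.
by rewrite lee_fin costE; apply: lp_weak_duality Wp p0 Wb yz0.
Qed.

(** Strong duality with attainment.  The witness is optimal by weak duality,
    since its objective reaches the optimal value of the relaxation. *)
Lemma lp_dual_attained b beta : lp_feasible Wy Wz b !=set0 ->
  min_value (cost q r) (lp_feasible Wy Wz b) = beta%:E ->
  exists2 p, dual_optimal q r Wy Wz b p & dotcv p b = beta.
Proof.
move=> [[y0 z0] /lp_feasibleE[W0 yz0]] valE.
have [|x Ax xge0|p [Wp p0 le_beta]] :=
    @lp_dual_witness _ _ _ (row_mx Wy Wz) b (col_mx q r) beta.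
- by exists (col_mx y0 z0).
- rewrite -(vsubmxK x) -costE -lee_fin -valE.
  apply: ereal_inf_lbound; exists (usubmx x, dsubmx x) => //.
  by apply/lp_feasibleE; rewrite vsubmxK.
have pF : dual_feasible q r Wy Wz p by apply/dual_feasibleE.
have dualP p' : dual_feasible q r Wy Wz p' -> dotcv p' b <= beta.
  by move=> p'F; rewrite -lee_fin -valE; apply: dual_le_lp_value.
have pE : dotcv p b = beta by apply/le_anti; rewrite le_beta dualP.
by exists p => //; split=> // p' p'F; rewrite pE dualP.
Qed.

End SecondStageDuality.

Theorem proposition5p6 (R : realType) (n1 d nC nI m : nat)
  (X : set 'cV[R]_n1) (Xi : set 'cV[R]_d)
  (q : 'cV[R]_nC) (r : 'cV[R]_nI)
  (Wy : 'M[R]_(m, nC)) (Wz : 'M[R]_(m, nI))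
  (h : 'cV[R]_d -> 'cV[R]_m) (T : 'cV[R]_d -> 'M[R]_(m, n1))
  (Mpi gamma Rbar : R)
  (X_closed : closed X) (X_nonempty : X !=set0)
  (Q_attained : forall x xi, X x -> Xi xi ->
     exists yz, is_minimizer (cost q r) (mip_feasible Wy Wz (rhs h T x xi)) yz)
  (Mpi_gt0 : 0 < Mpi)
  (dual_bound : forall x xi p, X x -> Xi xi ->
     dual_optimal q r Wy Wz (rhs h T x xi) p -> `|p| <= Mpi)
  (gamma_gt0 : 0 < gamma)
  (gap_bound :
     (ereal_sup [set Q q r Wy Wz h T x.1 x.2 - QLP q r Wy Wz h T x.1 x.2
                | x in X `*` Xi] <= gamma%:E)%E)
  (X_bound : forall x, X x -> `|x| <= Rbar) :
  forall xi xi', Xi xi -> Xi xi' ->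
    (regret q r Wy Wz h T X xi xi' <=
      (Mpi * (norm1 (h xi - h xi') + Rbar * norm1 (T xi - T xi'))
        + gamma)%:E)%E.
Proof.
move=> xi xi' Xxi Xxi'; apply: ge_ereal_sup => _ [x Xx <-].
have [yz [yzF yzmin]] := Q_attained x xi Xx Xxi.
have [yz' [yz'F yz'min]] := Q_attained x xi' Xx Xxi'.
have QE : Q q r Wy Wz h T x xi = (cost q r yz)%:E.
  by apply: min_value_minimizer; split.
have QE' : Q q r Wy Wz h T x xi' = (cost q r yz')%:E.
  by apply: min_value_minimizer; split.
have QLP_le : (QLP q r Wy Wz h T x xi <= (cost q r yz)%:E)%E.
  by apply: ereal_inf_lbound; exists yz => //; apply: mip_sub_lp.
have QLP_le' : (QLP q r Wy Wz h T x xi' <= (cost q r yz')%:E)%E.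
  by apply: ereal_inf_lbound; exists yz' => //; apply: mip_sub_lp.
have gap : ((cost q r yz)%:E - QLP q r Wy Wz h T x xi <= gamma%:E)%E.
  rewrite -QE; apply: le_trans gap_bound.
  by apply: ereal_sup_ubound; exists (x, xi).
have [beta QLPE] : exists beta, QLP q r Wy Wz h T x xi = beta%:E.
  move: QLP_le gap; case: (QLP q r Wy Wz h T x xi) => [beta| |] //=.
  by exists beta.
have [p p_opt pE] : exists2 p, dual_optimal q r Wy Wz (rhs h T x xi) p &
    dotcv p (rhs h T x xi) = beta.
  by apply: lp_dual_attained QLPE; exists yz; apply: mip_sub_lp.
have p_le' : dotcv p (rhs h T x xi') <= cost q r yz'.
  by rewrite -lee_fin; apply: le_trans QLP_le'; apply: dual_le_lp_value p_opt.1.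
have beta_le : beta <= dotcv p (rhs h T x xi') +
    Mpi * (norm1 (h xi - h xi') + Rbar * norm1 (T xi - T xi')).
  rewrite -pE -lerBlDl -dotcvBr; apply: le_trans (dotcv_le_norm _ _) _.
  apply: ler_pM; [exact: normr_ge0|exact: norm1_ge0|exact: dual_bound p_opt|].
  have -> : rhs h T x xi - rhs h T x xi' =
      (h xi - h xi') - (T xi - T xi') *m x.
    by rewrite /rhs mulmxBl !opprD addrACA.
  apply: le_trans (norm1B_le _ _) _; rewrite lerD2l.
  apply: le_trans (norm1_mulmx_le _ _) _.
  by rewrite ler_wpM2r ?norm1_ge0 // X_bound.
move: gap; rewrite QLPE QE QE' -!EFinB !lee_fin; lra.
Qed.
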